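(* Let $k$ be a field. For any scheme $X$ over $k$ equipped with a $k$-rational point $x$ and for any group scheme $H$ over $k$, we have an isomorphism of group functors $$\mathbf{Hom}(X,H)\simeq\mathbf{Hom}(X,H;x\mapsto e_H)\rtimes H,$$ where $H$ is identified with the subgroup functor of constant morphisms in $\mathbf{Hom}(X,H)$.
   Context: Conventions: schemes are over the field $k$ and are assumed separated and locally of finite type; morphisms and products are over $k$. Group schemes are thus locally of finite type over $k$; $e_H$ is the neutral element of $H$. $\mathbf{Hom}(X,H)$ is the contravariant functor from schemes to sets $S\mapsto\mathrm{Hom}(X\times S,H)$ (morphisms of schemes); it is a group functor by pointwise multiplication in $H$. $\mathbf{Hom}(X,H;x\mapsto e_H)$ is the normal subgroup functor whose $S$-points are the $f:X\times S\to H$ with $f(x,s)=e_H$ identically on $S$. The subgroup functor $H$ of constant morphisms consists of the morphisms $X\times S\to H$ of the form $h\circ\mathrm{pr}_S$ with $h\in H(S)$. *)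

(* Defs.v *)
From HB Require Import structures.
From mathcomp Require Import all_boot ssralg generic_quotient.
From mathcomp Require Import boolp classical_sets functions topology_structure.
From mathcomp Require Import ring.
Set Implicit Arguments.
Unset Strict Implicit.
Unset Printing Implicit Defensive.
Import GRing.Theory.
Local Open Scope classical_set_scope.
Local Open Scope ring_scope.
Local Open Scope quotient_scope.

(* Schemes are locally ringed spaces that are locally isomorphic to spectra of
   commutative rings, with structure sheaves of sections written out as families
   of rings indexed by open sets. Rings are comPzRingType because the zero ring
   must be allowed (sections over the empty set); MathComp's idealr and
   prime_idealr are not used because they need a nonzero ring. *)

Record prime_ideal (A : comPzRingType) := PrimeIdeal {
  pideal :> A -> Prop;
  prime0 : pideal 0;
  primeD : forall a b, pideal a -> pideal b -> pideal (a + b);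
  primeMl : forall a b, pideal b -> pideal (a * b);
  prime1 : ~ pideal 1;
  primeM : forall a b, pideal (a * b) -> pideal a \/ pideal b }.

Section Localization.
Variables (A : comPzRingType) (p : prime_ideal A).

Record ratio := Ratio { num : A; den : A; denP : ~ p den }.
HB.instance Definition _ := gen_eqMixin ratio.
HB.instance Definition _ := gen_choiceMixin ratio.

Definition ratio_eq (x y : ratio) : bool :=
  `[< exists u, ~ p u /\ u * (num x * den y) = u * (num y * den x) >].

Lemma prime_mulN a b : ~ p a -> ~ p b -> ~ p (a * b).
Proof. by move=> pa pb /primeM []. Qed.

Lemma ratio_eq_refl : reflexive ratio_eq.
Proof. by move=> x; apply/asboolP; exists 1; split => //; exact: prime1. Qed.

Lemma ratio_eq_sym : symmetric ratio_eq.
Proof.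
by move=> x y; apply/asboolP/asboolP => -[u [pu e]]; exists u; split.
Qed.

Lemma ratio_eq_trans : transitive ratio_eq.
Proof.
move=> y x z /asboolP[u [pu e]] /asboolP[v [pv e']]; apply/asboolP.
exists (u * v * den y); split.
  by do 2?[apply: prime_mulN => //]; exact: denP.
transitivity (v * den z * (u * (num x * den y))); first by ring.
rewrite e; transitivity (u * den x * (v * (num y * den z))); first by ring.
by rewrite e'; ring.
Qed.

Canonical ratio_equiv := EquivRel ratio_eq ratio_eq_refl ratio_eq_sym ratio_eq_trans.
Definition loc := {eq_quot ratio_eq}.
HB.instance Definition _ : EqQuotient _ ratio_eq loc := EqQuotient.on loc.
HB.instance Definition _ := Choice.on loc.

Definition frac a f (pf : ~ p f) : loc := \pi_loc (Ratio a pf).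

Lemma fracP a f (pf : ~ p f) b g (pg : ~ p g) :
  frac a pf = frac b pg <-> exists u, ~ p u /\ u * (a * g) = u * (b * f).
Proof.
split=> [/eqmodP/asboolP//|h]; first by apply/eqmodP/asboolP.
Qed.

Lemma loc_frac (z : loc) : exists a f (pf : ~ p f), z = frac a pf.
Proof. by elim/quotW: z => -[a f pf]; exists a, f, pf. Qed.

Lemma repr_fracP a f (pf : ~ p f) : exists u, ~ p u /\
  u * (num (repr (frac a pf)) * f) = u * (a * den (repr (frac a pf))).
Proof.
have /eqmodP/asboolP[u [pu e]] : \pi_loc (repr (frac a pf)) = \pi_loc (Ratio a pf).
  by rewrite reprK.
by exists u.
Qed.

Definition loc_add (z w : loc) : loc := let x := repr z in let y := repr w in
  frac (num x * den y + num y * den x) (prime_mulN (@denP x) (@denP y)).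
Definition loc_mul (z w : loc) : loc := let x := repr z in let y := repr w in
  frac (num x * num y) (prime_mulN (@denP x) (@denP y)).
Definition loc_opp (z : loc) : loc := let x := repr z in frac (- num x) (@denP x).

Lemma loc_addE a f (pf : ~ p f) b g (pg : ~ p g) :
  loc_add (frac a pf) (frac b pg) = frac (a * g + b * f) (prime_mulN pf pg).
Proof.
apply/fracP; have [u [pu e]] := repr_fracP a pf.
have [v [pv e']] := repr_fracP b pg.
move: (repr (frac a pf)) (repr (frac b pg)) e e' => [a' f' pf'] [b' g' pg'] /= e e'.
exists (u * v); split; first exact: prime_mulN.
transitivity ((v * g' * g) * (u * (a' * f)) + (u * f' * f) * (v * (b' * g))); first by ring.
by rewrite e e'; ring.
Qed.

Lemma loc_mulE a f (pf : ~ p f) b g (pg : ~ p g) :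
  loc_mul (frac a pf) (frac b pg) = frac (a * b) (prime_mulN pf pg).
Proof.
apply/fracP; have [u [pu e]] := repr_fracP a pf.
have [v [pv e']] := repr_fracP b pg.
move: (repr (frac a pf)) (repr (frac b pg)) e e' => [a' f' pf'] [b' g' pg'] /= e e'.
exists (u * v); split; first exact: prime_mulN.
transitivity ((u * (a' * f)) * (v * (b' * g))); first by ring.
by rewrite e e'; ring.
Qed.

Lemma loc_oppE a f (pf : ~ p f) : loc_opp (frac a pf) = frac (- a) pf.
Proof.
apply/fracP; have [u [pu e]] := repr_fracP a pf.
move: (repr (frac a pf)) e => [a' f' pf'] /= e.
exists u; split=> //; transitivity (- (u * (a' * f))); first by ring.
by rewrite e; ring.
Qed.

Definition loc0 : loc := frac 0 (@prime1 A p).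
Definition loc1 : loc := frac 1 (@prime1 A p).

Ltac loc_ring := rewrite ?(loc_addE, loc_mulE, loc_oppE); apply/fracP; exists 1;
  split; [exact: prime1 | ring].

Lemma loc_addA : associative loc_add.
Proof.
move=> x y z; have [a [f [pf ->]]] := loc_frac x; have [b [g [pg ->]]] := loc_frac y.
by have [c [h [ph ->]]] := loc_frac z; loc_ring.
Qed.
Lemma loc_addC : commutative loc_add.
Proof.
move=> x y; have [a [f [pf ->]]] := loc_frac x; have [b [g [pg ->]]] := loc_frac y.
by loc_ring.
Qed.
Lemma loc_add0 : left_id loc0 loc_add.
Proof. by move=> x; have [a [f [pf ->]]] := loc_frac x; loc_ring. Qed.
Lemma loc_addN : left_inverse loc0 loc_opp loc_add.
Proof. by move=> x; have [a [f [pf ->]]] := loc_frac x; loc_ring. Qed.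
HB.instance Definition _ :=
  GRing.isZmodule.Build loc loc_addA loc_addC loc_add0 loc_addN.

Lemma loc_mulA : associative loc_mul.
Proof.
move=> x y z; have [a [f [pf ->]]] := loc_frac x; have [b [g [pg ->]]] := loc_frac y.
by have [c [h [ph ->]]] := loc_frac z; loc_ring.
Qed.
Lemma loc_mulC : commutative loc_mul.
Proof.
move=> x y; have [a [f [pf ->]]] := loc_frac x; have [b [g [pg ->]]] := loc_frac y.
by loc_ring.
Qed.
Lemma loc_mul1 : left_id loc1 loc_mul.
Proof. by move=> x; have [a [f [pf ->]]] := loc_frac x; loc_ring. Qed.
Lemma loc_mulDl : left_distributive loc_mul +%R.
Proof.
move=> x y z; have [a [f [pf ->]]] := loc_frac x; have [b [g [pg ->]]] := loc_frac y.
have [c [h [ph ->]]] := loc_frac z; rewrite -[+%R]/loc_add; loc_ring.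
Qed.
HB.instance Definition _ :=
  GRing.Zmodule_isComPzRing.Build loc loc_mulA loc_mulC loc_mul1 loc_mulDl.

Lemma fracD a f (pf : ~ p f) b g (pg : ~ p g) :
  frac a pf + frac b pg = frac (a * g + b * f) (prime_mulN pf pg).
Proof. exact: loc_addE. Qed.
Lemma fracM a f (pf : ~ p f) b g (pg : ~ p g) :
  frac a pf * frac b pg = frac (a * b) (prime_mulN pf pg).
Proof. exact: loc_mulE. Qed.
Lemma fracN a f (pf : ~ p f) : - frac a pf = frac (- a) pf.
Proof. exact: loc_oppE. Qed.
Lemma frac0 : 0 = frac 0 (@prime1 A p). Proof. by []. Qed.
Lemma frac1 : 1 = frac 1 (@prime1 A p). Proof. by []. Qed.
End Localization.

(* Closed sets of Spec A are the V(E) = [set p | E `<=` p]. *)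
Section SpecTopology.
Variable A : comPzRingType.
HB.instance Definition _ := gen_eqMixin (prime_ideal A).
HB.instance Definition _ := gen_choiceMixin (prime_ideal A).

Definition zero_locus (E : set A) : set (prime_ideal A) :=
  [set p | forall f, E f -> p f].
Definition zariski_open (U : set (prime_ideal A)) : Prop :=
  exists E, U = ~` zero_locus E.

Lemma zariski_openP U : zariski_open U <->
  forall p, U p -> exists2 f, ~ p f & forall q : prime_ideal A, ~ q f -> U q.
Proof.
split=> [[E ->] p /existsNP[f /not_implyP[Ef pf]]|h].
  by exists f => // q qf; apply/existsNP; exists f => /(_ Ef).
exists [set f | forall q : prime_ideal A, ~ q f -> U q].
rewrite predeqE => p; split=> [/h[f pf fU]|/existsNP[f /not_implyP[Ef pf]]].
  by apply/existsNP; exists f => /(_ fU).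
exact: Ef.
Qed.

Lemma zariski_openT : zariski_open setT.
Proof. by apply/zariski_openP => p _; exists 1 => //; exact: prime1. Qed.
Lemma zariski_openI : setI_closed zariski_open.
Proof.
move=> U V /zariski_openP hU /zariski_openP hV; apply/zariski_openP => p [Up Vp].
have [f pf fU] := hU _ Up; have [g pg gV] := hV _ Vp.
exists (f * g) => [|q qfg]; first exact: prime_mulN.
split; [apply: fU | apply: gV] => h; apply: qfg; last exact: primeMl.
by rewrite mulrC; exact: primeMl.
Qed.
Lemma zariski_open_bigU (I : Type) (F : I -> set (prime_ideal A)) :
  (forall i, zariski_open (F i)) -> zariski_open (\bigcup_i F i).
Proof.
move=> h; apply/zariski_openP => p [i _ Fp].
have /zariski_openP/(_ _ Fp)[f pf fF] := h i.
by exists f => // q /fF Fq; exists i.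
Qed.
HB.instance Definition _ := isOpenTopological.Build (prime_ideal A)
  zariski_openT zariski_openI zariski_open_bigU.
End SpecTopology.

(* Primitive projections make the preimage of U under the identity, and the
   preimage under a composite, convertible to U and to the iterated preimage;
   hence sheaf morphisms compose without casts. *)
Set Primitive Projections.
Record opens (T : topologicalType) := Opens { oset :> set T; oopen : open oset }.
Unset Primitive Projections.

Lemma opens_eq (T : topologicalType) (U V : opens T) : oset U = oset V -> U = V.
Proof. by case: U V => [U oU] [V oV] /= e; subst V; rewrite (Prop_irrelevance oU oV). Qed.

Definition otop (T : topologicalType) : opens T := Opens openT.

Record ringed_space := RingedSpace {
  rpt :> topologicalType;
  sec : opens rpt -> comPzRingType;
  res : forall U V : opens rpt, V `<=` U -> sec U -> sec V;
  res_zmod : forall (U V : opens rpt) (h : V `<=` U), zmod_morphism (res h);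
  res_monoid : forall (U V : opens rpt) (h : V `<=` U), GRing.monoid_morphism (res h);
  res_id : forall (U : opens rpt) (h : U `<=` U) s, res h s = s;
  res_comp : forall (U V W : opens rpt) (h : V `<=` U) (h' : W `<=` V) (h'' : W `<=` U) s,
    res h' (res h s) = res h'' s;
  sec_separated : forall (I : Type) (V : I -> opens rpt) (U : opens rpt)
    (h : forall i, V i `<=` U), U `<=` \bigcup_i V i ->
    forall s t : sec U, (forall i, res (h i) s = res (h i) t) -> s = t;
  sec_glue : forall (I : Type) (V : I -> opens rpt) (U : opens rpt)
    (h : forall i, V i `<=` U), U `<=` \bigcup_i V i ->
    forall s : forall i, sec (V i),
    (forall i j (W : opens rpt) (hi : W `<=` V i) (hj : W `<=` V j),
      res hi (s i) = res hj (s j)) ->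
    exists t : sec U, forall i, res (h i) t = s i }.

(* Sections over U are families in \prod_(p in U) A_p that are locally of the form
   a / f; restriction is restriction of functions. *)
Section SpecSheaf.
Variable A : comPzRingType.
Notation X := (prime_ideal A).

Record spec_sec (U : opens X) := SpecSec {
  sval : forall p : X, oset U p -> loc p;
  sfracP : forall p, oset U p -> exists a f, exists V : opens X,
    [/\ oset V p, V `<=` U & forall q (Uq : oset U q), oset V q ->
      exists qf : ~ q f, sval Uq = frac a qf] }.

Lemma spec_sec_eq U (s t : spec_sec U) :
  (forall p (Up : oset U p), sval s Up = sval t Up) -> s = t.
Proof.
case: s t => [s hs] [t ht] /= e.
have {}e : s = t by apply: functional_extensionality_dep => p; apply: funext => Up.
by subst t; rewrite (Prop_irrelevance hs ht).
Qed.

Definition oI (T : topologicalType) (U V : opens T) : opens T :=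
  Opens (openI (oopen U) (oopen V)).

Definition spec_const U (a : A) : spec_sec U.
Proof.
exists (fun p _ => frac a (@prime1 A p)) => p Up.
by exists a, 1, U; split=> // q Uq _; exists (@prime1 A q).
Defined.

Definition spec_add U (s t : spec_sec U) : spec_sec U.
Proof.
exists (fun p Up => sval s Up + sval t Up) => p Up.
have [a [f [V [Vp VU Vs]]]] := sfracP s Up.
have [b [g [W [Wp WU Wt]]]] := sfracP t Up.
exists (a * g + b * f), (f * g), (oI V W); split=> [//|q [/VU]//|q Uq [Vq Wq]].
have [qf ->] := Vs q Uq Vq; have [qg ->] := Wt q Uq Wq.
by exists (prime_mulN qf qg); rewrite fracD.
Defined.

Definition spec_mul U (s t : spec_sec U) : spec_sec U.
Proof.
exists (fun p Up => sval s Up * sval t Up) => p Up.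
have [a [f [V [Vp VU Vs]]]] := sfracP s Up.
have [b [g [W [Wp WU Wt]]]] := sfracP t Up.
exists (a * b), (f * g), (oI V W); split=> [//|q [/VU]//|q Uq [Vq Wq]].
have [qf ->] := Vs q Uq Vq; have [qg ->] := Wt q Uq Wq.
by exists (prime_mulN qf qg); rewrite fracM.
Defined.

Definition spec_opp U (s : spec_sec U) : spec_sec U.
Proof.
exists (fun p Up => - sval s Up) => p Up.
have [a [f [V [Vp VU Vs]]]] := sfracP s Up.
exists (- a), f, V; split=> // q Uq Vq.
by have [qf ->] := Vs q Uq Vq; exists qf; rewrite fracN.
Defined.

HB.instance Definition _ U := gen_eqMixin (spec_sec U).
HB.instance Definition _ U := gen_choiceMixin (spec_sec U).

Section Ring.
Variable U : opens X.
Lemma spec_addA : associative (@spec_add U).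
Proof. by move=> x y z; apply: spec_sec_eq => p Up /=; rewrite addrA. Qed.
Lemma spec_addC : commutative (@spec_add U).
Proof. by move=> x y; apply: spec_sec_eq => p Up /=; rewrite addrC. Qed.
Lemma spec_add0 : left_id (spec_const U 0) (@spec_add U).
Proof. by move=> x; apply: spec_sec_eq => p Up /=; rewrite -frac0 add0r. Qed.
Lemma spec_addN : left_inverse (spec_const U 0) (@spec_opp U) (@spec_add U).
Proof. by move=> x; apply: spec_sec_eq => p Up /=; rewrite -frac0 addNr. Qed.
HB.instance Definition _ :=
  GRing.isZmodule.Build (spec_sec U) spec_addA spec_addC spec_add0 spec_addN.
Lemma spec_mulA : associative (@spec_mul U).
Proof. by move=> x y z; apply: spec_sec_eq => p Up /=; rewrite mulrA. Qed.
Lemma spec_mulC : commutative (@spec_mul U).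
Proof. by move=> x y; apply: spec_sec_eq => p Up /=; rewrite mulrC. Qed.
Lemma spec_mul1 : left_id (spec_const U 1) (@spec_mul U).
Proof. by move=> x; apply: spec_sec_eq => p Up /=; rewrite -frac1 mul1r. Qed.
Lemma spec_mulDl : left_distributive (@spec_mul U) +%R.
Proof. by move=> x y z; apply: spec_sec_eq => p Up /=; rewrite mulrDl. Qed.
HB.instance Definition _ :=
  GRing.Zmodule_isComPzRing.Build (spec_sec U) spec_mulA spec_mulC spec_mul1 spec_mulDl.
End Ring.

Definition spec_res (U V : opens X) (h : V `<=` U) (s : spec_sec U) : spec_sec V.
Proof.
exists (fun p Vp => sval s (h p Vp)) => p Vp.
have [a [f [W [Wp WU Ws]]]] := sfracP s (h p Vp).
exists a, f, (oI W V); split=> [//|q []//|q Vq [Wq _]].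
exact: Ws.
Defined.

Lemma spec_separated (I : Type) (V : I -> opens X) (U : opens X)
  (h : forall i, V i `<=` U) : U `<=` \bigcup_i V i ->
  forall s t : spec_sec U, (forall i, spec_res (h i) s = spec_res (h i) t) -> s = t.
Proof.
move=> cov s t e; apply: spec_sec_eq => p Up; have [i _ Vp] := cov _ Up.
have := congr1 (fun r => sval r Vp) (e i).
by rewrite /= (Prop_irrelevance (h i p Vp) Up).
Qed.

Lemma spec_glue (I : Type) (V : I -> opens X) (U : opens X)
  (h : forall i, V i `<=` U) : U `<=` \bigcup_i V i ->
  forall s : forall i, spec_sec (V i),
  (forall i j (W : opens X) (hi : W `<=` V i) (hj : W `<=` V j),
    spec_res hi (s i) = spec_res hj (s j)) ->
  exists t : spec_sec U, forall i, spec_res (h i) t = s i.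
Proof.
move=> cov s e.
have e' i j p (hi : oset (V i) p) (hj : oset (V j) p) : sval (s i) hi = sval (s j) hj.
  have := e i j (oI (V i) (V j)) (@subIsetl _ _ _) (@subIsetr _ _ _).
  move=> /(congr1 (fun r : spec_sec (oI (V i) (V j)) => sval r (p:=p) (conj hi hj))) /=.
  set x := (X in sval _ X = _); set y := (X in _ = sval _ X).
  by rewrite (Prop_irrelevance x hi) (Prop_irrelevance y hj).
have c p : oset U p -> {i | oset (V i) p}.
  by move=> Up; apply: cid; have [i _ Vp] := cov _ Up; exists i.
pose t p (Up : oset U p) : loc p := sval (s (projT1 (c p Up))) (projT2 (c p Up)).
have tE p (Up : oset U p) i (Vp : oset (V i) p) : t p Up = sval (s i) Vp by exact: e'.
have ht p : oset U p -> exists a f, exists W : opens X,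
    [/\ oset W p, W `<=` U & forall q (Uq : oset U q), oset W q ->
      exists qf : ~ q f, t q Uq = frac a qf].
  move=> Up; have [i _ Vp] := cov _ Up.
  have [a [f [W [Wp WV Ws]]]] := sfracP (s i) Vp.
  exists a, f, W; split=> // [q /WV/h//|q Uq Wq].
  have [qf e2] := Ws q (WV _ Wq) Wq; exists qf; rewrite -e2; exact: tE.
by exists (SpecSec ht) => i; apply: spec_sec_eq => p Vp /=; exact: tE.
Qed.

Definition Spec : ringed_space.
Proof.
refine (@RingedSpace X (fun U => spec_sec U) spec_res _ _ _ _ spec_separated spec_glue).
- by move=> U V h x y; exact: spec_sec_eq.
- by move=> U V h; split=> [|x y]; exact: spec_sec_eq.
- by move=> U h s; apply: spec_sec_eq => p Up /=; rewrite (Prop_irrelevance (h p Up) Up).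
- move=> U V W h h' h'' s; apply: spec_sec_eq => p Up /=.
  by rewrite (Prop_irrelevance (h p _) (h'' p Up)).
Defined.
End SpecSheaf.

(* The germ of s at x is a unit of the stalk O_{X,x}: an inverse germ is
   represented on some smaller neighbourhood of x. Likewise local_stalks says that
   each O_{X,x} is a local ring (1 <> 0, and if a sum is a unit then so is one of
   its terms), and local_map that the maps on stalks reflect units, in terms of
   representatives of germs. *)
Definition germ_unit (X : ringed_space) (x : X) (U : opens X) (s : sec U) : Prop :=
  exists (V : opens X) (h : V `<=` U), oset V x /\ exists t, res h s * t = 1.

Definition local_stalks (X : ringed_space) : Prop := forall x : X,
  (forall U : opens X, oset U x -> (1 : sec U) <> 0) /\
  (forall (U : opens X) (s t : sec U), oset U x ->
    germ_unit x (s + t) -> germ_unit x s \/ germ_unit x t).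

(* fcont is library continuity in the form of continuousP; the comorphism of f
   goes from O_Y(V) to O_X(f^-1 V). *)
Record rsmap (X Y : ringed_space) := RSMap {
  fpt :> X -> Y;
  fcont : forall V, open V -> open (fpt @^-1` V);
  fsh : forall V : opens Y, sec V -> sec (Opens (fcont (oopen V)));
  fsh_zmod : forall V : opens Y, zmod_morphism (@fsh V);
  fsh_monoid : forall V : opens Y, GRing.monoid_morphism (@fsh V);
  fsh_res : forall (V W : opens Y) (h : W `<=` V)
    (h' : Opens (fcont (oopen W)) `<=` Opens (fcont (oopen V))) s,
    fsh (res h s) = res h' (fsh s) }.

Definition opre X Y (f : rsmap X Y) (V : opens Y) : opens X := Opens (fcont f (oopen V)).

Definition rs_id (X : ringed_space) : rsmap X X.
Proof.
refine (@RSMap X X id (fun V oV => oV) (fun V s => s) _ _ _) => //.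
by move=> V W h h' s; rewrite (Prop_irrelevance h h').
Defined.

Definition rs_comp (X Y Z : ringed_space) (g : rsmap Y Z) (f : rsmap X Y) : rsmap X Z.
Proof.
refine (@RSMap X Z (g \o f) (fun V oV => fcont f (fcont g oV))
  (fun V s => fsh f (fsh g s)) _ _ _).
- by move=> V s t; rewrite !fsh_zmod.
- by move=> V; split=> [|s t]; rewrite !fsh_monoid.
- move=> V W h h' s; have hg : opre g W `<=` opre g V by move=> y; exact: h.
  by rewrite (@fsh_res _ _ g _ _ h hg) (@fsh_res _ _ f _ _ hg h').
Defined.

(* Isomorphism of X with the open ringed subspace of Y carried by range f. *)
Definition open_immersion (X Y : ringed_space) (f : rsmap X Y) : Prop :=
  [/\ injective f,
      forall U : set X, open U -> open (f @` U) &
      forall V : opens Y, V `<=` range f -> bijective (@fsh X Y f V)].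

(* Homeomorphism onto a closed subset, with O_Y -> f_* O_X surjective as a
   morphism of sheaves, i.e. locally on Y. *)
Definition closed_immersion (X Y : ringed_space) (f : rsmap X Y) : Prop :=
  [/\ injective f,
      forall C : set X, closed C -> closed (f @` C) &
      forall (V : opens Y) (s : sec (opre f V)) (y : Y), oset V y ->
        exists (W : opens Y) (h : W `<=` V) (h' : opre f W `<=` opre f V),
          oset W y /\ exists t : sec W, fsh f t = res h' s].

Record scheme := Scheme {
  srs :> ringed_space;
  sch_local : local_stalks srs;
  sch_affine : forall x : srs, exists (A : comPzRingType) (f : rsmap (Spec A) srs),
    open_immersion f /\ range f x }.

Definition local_map (X Y : ringed_space) (f : rsmap X Y) : Prop :=
  forall (x : X) (V : opens Y) (s : sec V), oset V (f x) ->
    germ_unit x (fsh f s) -> germ_unit (f x) s.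

Record smap (X Y : scheme) := SMap { smrs :> rsmap X Y; sm_local : local_map smrs }.

Lemma spec_local (A : comPzRingType) : local_stalks (Spec A).
Proof.
have unitP (p : prime_ideal A) (U : opens (prime_ideal A)) (Up : oset U p) (s : spec_sec U) a f (pf : ~ p f) :
    sval s Up = frac a pf -> (germ_unit (X := Spec A) p s <-> ~ p a).
  move=> e; split=> [[V [h [Vp [t]]]] |pa].
    move=> /(congr1 (fun r : spec_sec V => sval r Vp)) /=.
    rewrite (Prop_irrelevance (h p Vp) Up) e; have [b [g [pg ->]]] := loc_frac (sval t Vp).
    rewrite fracM => /fracP[u [pu e']] pa.
    have : p (u * (1 * (f * g))).
      by rewrite -e' mulr1 mulrA mulrC; apply: primeMl; exact: primeMl.
    by do 4?[case/primeM => //]; exact: prime1.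
  have [a' [f' [V [Vp VU Vs]]]] := sfracP s Up.
  have oD : open ((V : set _) `&` [set q | ~ q a'] : set (prime_ideal A)).
    apply: openI; first exact: oopen.
    by apply: (iffRL (zariski_openP _)) => q qa'; exists a'.
  have pa' : ~ p a'.
    have [pf' e'] := Vs p Up Vp; move: e'; rewrite e => /fracP[u [pu e']] pa'.
    have : p (u * (a * f')) by rewrite e' mulrA mulrC; apply: primeMl; exact: primeMl.
    by do 2?[case/primeM => //].
  pose W := Opens oD; have h : W `<=` U by move=> q [/VU].
  exists W, h; split=> //.
  have tP (q : prime_ideal A) (Wq : oset W q) : exists b g, exists V : opens (prime_ideal A),
      [/\ oset V q, V `<=` W & forall r (Wr : oset W r), oset V r ->
        exists rg : ~ r g, frac f' Wr.2 = frac b rg].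
    by exists f', a', W; split=> // r Wr _; exists Wr.2.
  exists (SpecSec tP); apply: spec_sec_eq => q Wq /=.
  have [qf' ->] := Vs q (h q Wq) Wq.1.
  rewrite fracM; apply/fracP; exists 1; split; [exact: prime1|ring].
move=> p; split=> [U Up /(congr1 (fun r : spec_sec U => sval r Up)) /=|].
  move=> /fracP[u [pu]]; rewrite mul0r mulr0 !mulr1 => u0.
  by apply: pu; rewrite u0; exact: prime0.
move=> U s t Up.
have [a [f [pf es]]] := loc_frac (sval (s : spec_sec U) Up).
have [b [g [pg et]]] := loc_frac (sval (t : spec_sec U) Up).
have est : sval (s + t : spec_sec U) Up = frac (a * g + b * f) (prime_mulN pf pg).
  by rewrite /= es et fracD.
move=> /(unitP _ _ _ _ _ _ _ est) h; have [pa|pa] := pselect (p a); last first.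
  by left; apply/(unitP _ _ _ _ _ _ _ es).
right; apply/(unitP _ _ _ _ _ _ _ et) => pb; apply: h.
by apply: primeD; rewrite mulrC; exact: primeMl.
Qed.

Lemma spec_affine (A : comPzRingType) (x : Spec A) :
  exists (B : comPzRingType) (f : rsmap (Spec B) (Spec A)), open_immersion f /\ range f x.
Proof.
exists A, (rs_id (Spec A)); split; last by exists x.
split=> [//|U|V _]; first by rewrite image_id.
by exists id.
Qed.

Definition SpecS (A : comPzRingType) : scheme := Scheme (@spec_local A) (@spec_affine A).

Lemma id_local (X : ringed_space) : local_map (rs_id X).
Proof. by move=> x V s _; case: V s. Qed.

Lemma comp_local X Y Z (g : rsmap Y Z) (f : rsmap X Y) :
  local_map g -> local_map f -> local_map (rs_comp g f).
Proof. by move=> hg hf x V s Vx /(hf x (opre g V)) h; apply: hg => //; exact: h. Qed.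

Definition s_id (X : scheme) : smap X X := SMap (@id_local X).
Definition s_comp (X Y Z : scheme) (g : smap Y Z) (f : smap X Y) : smap X Z :=
  SMap (comp_local (@sm_local _ _ g) (@sm_local _ _ f)).

Lemma smap_eq (X Y : scheme) (f g : smap X Y) : smrs f = smrs g -> f = g.
Proof. by case: f g => [f hf] [g hg] /= e; subst g; rewrite (Prop_irrelevance hf hg). Qed.

Lemma rsmap_irr (X Y : ringed_space) f c s z z' m m' r r' :
  @RSMap X Y f c s z m r = @RSMap X Y f c s z' m' r'.
Proof. by congr RSMap; exact: Prop_irrelevance. Qed.
Lemma rs_compA (X Y Z T : ringed_space) (h : rsmap Z T) (g : rsmap Y Z) (f : rsmap X Y) :
  rs_comp h (rs_comp g f) = rs_comp (rs_comp h g) f.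
Proof. exact: rsmap_irr. Qed.
Lemma rs_comp1f (X Y : ringed_space) (f : rsmap X Y) : rs_comp (rs_id Y) f = f.
Proof. by case: f => f c s z m r; exact: rsmap_irr. Qed.
Lemma rs_compf1 (X Y : ringed_space) (f : rsmap X Y) : rs_comp f (rs_id X) = f.
Proof. by case: f => f c s z m r; exact: rsmap_irr. Qed.

Lemma s_compA (X Y Z T : scheme) (h : smap Z T) (g : smap Y Z) (f : smap X Y) :
  s_comp h (s_comp g f) = s_comp (s_comp h g) f.
Proof. by apply: smap_eq; exact: rs_compA. Qed.
Lemma s_comp1f (X Y : scheme) (f : smap X Y) : s_comp (s_id Y) f = f.
Proof. by apply: smap_eq; exact: rs_comp1f. Qed.
Lemma s_compf1 (X Y : scheme) (f : smap X Y) : s_comp f (s_id X) = f.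
Proof. by apply: smap_eq; exact: rs_compf1. Qed.

Section SchemesOverField.
Variable k : fieldType.

Record kscheme := KScheme { ksch :> scheme; kstr : smap ksch (SpecS k) }.

Record khom (X Y : kscheme) := KHom {
  khs :> smap X Y;
  kh_over : s_comp (kstr Y) khs = kstr X }.

Lemma khom_eq (X Y : kscheme) (f g : khom X Y) : khs f = khs g -> f = g.
Proof. by case: f g => [f hf] [g hg] /= e; subst g; rewrite (Prop_irrelevance hf hg). Qed.

Definition kid (X : kscheme) : khom X X := KHom (s_compf1 (kstr X)).

Lemma kcomp_over X Y Z (g : khom Y Z) (f : khom X Y) :
  s_comp (kstr Z) (s_comp g f) = kstr X.
Proof. by rewrite s_compA !kh_over. Qed.
Definition kcomp X Y Z (g : khom Y Z) (f : khom X Y) : khom X Z :=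
  KHom (kcomp_over g f).

Lemma kcompA X Y Z T (h : khom Z T) (g : khom Y Z) (f : khom X Y) :
  kcomp h (kcomp g f) = kcomp (kcomp h g) f.
Proof. by apply: khom_eq; exact: s_compA. Qed.
Lemma kcomp1f X Y (f : khom X Y) : kcomp (kid Y) f = f.
Proof. by apply: khom_eq; exact: s_comp1f. Qed.
Lemma kcompf1 X Y (f : khom X Y) : kcomp f (kid X) = f.
Proof. by apply: khom_eq; exact: s_compf1. Qed.

(* Spec k, the terminal k-scheme; khom kpt X is the set X(k) of rational points. *)
Definition kpt : kscheme := KScheme (s_id (SpecS k)).
Definition to_kpt (X : kscheme) : khom X kpt := @KHom X kpt (kstr X) (s_comp1f (kstr X)).

Lemma to_kpt_uniq X (f : khom X kpt) : f = to_kpt X.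
Proof. by apply: khom_eq; rewrite /= -(kh_over f) /= s_comp1f. Qed.

(* A product in the category of all schemes over k, i.e. a fibre product over
   Spec k, given by its universal property. *)
Record kprod (X Y : kscheme) := KProd {
  kprod_obj :> kscheme;
  pr1 : khom kprod_obj X;
  pr2 : khom kprod_obj Y;
  kpair : forall T : kscheme, khom T X -> khom T Y -> khom T kprod_obj;
  pr1_kpair : forall T (f : khom T X) (g : khom T Y), kcomp pr1 (kpair f g) = f;
  pr2_kpair : forall T (f : khom T X) (g : khom T Y), kcomp pr2 (kpair f g) = g;
  kpair_uniq : forall T (f : khom T X) (g : khom T Y) (h : khom T kprod_obj),
    kcomp pr1 h = f -> kcomp pr2 h = g -> h = kpair f g }.

Lemma kpair_comp X Y (P : kprod X Y) T T' (f : khom T X) (g : khom T Y) (u : khom T' T) :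
  kcomp (kpair P f g) u = kpair P (kcomp f u) (kcomp g u).
Proof. by apply: kpair_uniq; rewrite kcompA ?pr1_kpair ?pr2_kpair. Qed.

Definition separated (X : kscheme) : Prop :=
  exists P : kprod X X, closed_immersion (kpair P (kid X) (kid X)).

(* B is generated as an R-algebra by finitely many elements. *)
Definition finite_type (R B : comPzRingType) (f : R -> B) : Prop :=
  exists s : seq B, forall Q : {pred B}, GRing.subring_closed Q ->
    (forall c, f c \in Q) -> {subset s <= Q} -> forall b, b \in Q.

(* The canonical map k -> O_X(X). *)
Definition kscalar (X : kscheme) (a : k) : sec (opre (kstr X) (otop (Spec k))) :=
  fsh (kstr X) (spec_const (otop (Spec k)) a : sec (otop (Spec k))).

Definition locally_finite_type (X : kscheme) : Prop :=
  forall x : X, exists (A : comPzRingType) (f : rsmap (Spec A) X),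
    [/\ open_immersion f, range f x & finite_type (fun a => fsh f (kscalar X a))].

(* The schemes of the statement: separated and locally of finite type over k. *)
Record ftscheme := FTScheme {
  ftsch :> kscheme;
  ft_sep : separated ftsch;
  ft_lft : locally_finite_type ftsch }.

(* Contravariant functors from ftscheme to groups, and their isomorphisms. *)
Record group_functor := GroupFunctor {
  gob :> ftscheme -> groupType;
  gmap : forall S T : ftscheme, khom T S -> gob S -> gob T;
  gmapM : forall (S T : ftscheme) (u : khom T S), {morph gmap u : a b / (a * b)%g};
  gmap_id : forall (S : ftscheme) a, gmap (kid S) a = a;
  gmap_comp : forall (S T R : ftscheme) (u : khom T S) (v : khom R T) a,
    gmap (kcomp u v) a = gmap v (gmap u a) }.

Record gf_iso (F G : group_functor) := GFIso {
  giso :> forall S, F S -> G S;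
  giso_bij : forall S, bijective (@giso S);
  gisoM : forall S, {morph @giso S : a b / (a * b)%g};
  giso_nat : forall (S T : ftscheme) (u : khom T S) a,
    giso (gmap u a) = gmap u (giso a) }.

Record subgroup_functor (G : group_functor) := SubgroupFunctor {
  sgmem : forall S, set (G S);
  sgmem1 : forall S, sgmem (1%g : G S);
  sgmemM : forall S (a b : G S), sgmem a -> sgmem b -> sgmem (a * b)%g;
  sgmemV : forall S (a : G S), sgmem a -> sgmem (a^-1)%g;
  sgmem_map : forall (S T : ftscheme) (u : khom T S) (a : G S),
    sgmem a -> sgmem (gmap u a) }.

Definition normal_functor (G : group_functor) (N : subgroup_functor G) : Prop :=
  forall S (g n : G S), sgmem N n -> sgmem N (g * n * g^-1)%g.


Section SubgroupFunctor.
Variables (G : group_functor) (N : subgroup_functor G).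

Section Elements.
Variable S : ftscheme.
Record sgelt := SGElt { sgval :> G S; sgvalP : sgmem N sgval }.
HB.instance Definition _ := gen_eqMixin sgelt.
HB.instance Definition _ := gen_choiceMixin sgelt.

Lemma sgelt_eq (a b : sgelt) : sgval a = sgval b -> a = b.
Proof. by case: a b => [a ha] [b hb] /= e; subst b; rewrite (Prop_irrelevance ha hb). Qed.

Definition sg1 : sgelt := SGElt (sgmem1 N S).
Definition sgmul (a b : sgelt) : sgelt := SGElt (sgmemM (sgvalP a) (sgvalP b)).
Definition sginv (a : sgelt) : sgelt := SGElt (sgmemV (sgvalP a)).

Lemma sgmulA : associative sgmul.
Proof. by move=> a b c; apply: sgelt_eq => /=; rewrite mulgA. Qed.
Lemma sgmul1g : left_id sg1 sgmul.
Proof. by move=> a; apply: sgelt_eq => /=; rewrite mul1g. Qed.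
Lemma sgmulg1 : right_id sg1 sgmul.
Proof. by move=> a; apply: sgelt_eq => /=; rewrite mulg1. Qed.
Lemma sgmulVg : left_inverse sg1 sginv sgmul.
Proof. by move=> a; apply: sgelt_eq => /=; rewrite mulVg. Qed.
Lemma sgmulgV : right_inverse sg1 sginv sgmul.
Proof. by move=> a; apply: sgelt_eq => /=; rewrite mulgV. Qed.
HB.instance Definition _ := isGroup.Build sgelt sgmulA sgmul1g sgmulg1 sgmulVg sgmulgV.
End Elements.

Definition sgmap (S T : ftscheme) (u : khom T S) (a : sgelt S) : sgelt T :=
  SGElt (sgmem_map u (sgvalP a)).

Definition sub_functor : group_functor.
Proof.
refine (@GroupFunctor (fun S => sgelt S) sgmap _ _ _).
- by move=> S T u a b; apply: sgelt_eq; exact: gmapM.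
- by move=> S a; apply: sgelt_eq; exact: gmap_id.
- by move=> S T R u v a; apply: sgelt_eq; exact: gmap_comp.
Defined.
End SubgroupFunctor.

Record gf_action (K N : group_functor) := GFAction {
  gact :> forall S, K S -> N S -> N S;
  gactM : forall S (h : K S), {morph gact h : a b / (a * b)%g};
  gact1 : forall S (a : N S), gact 1%g a = a;
  gact_mul : forall S (h h' : K S) (a : N S), gact (h * h')%g a = gact h (gact h' a);
  gact_nat : forall (S T : ftscheme) (u : khom T S) (h : K S) (a : N S),
    gmap u (gact h a) = gact (gmap u h) (gmap u a) }.

(* Pairs (n, h) with (n, h)(n', h') = (n (h . n'), h h'). *)
Section SemidirectProduct.
Variables (K N : group_functor) (act : gf_action K N).

Record sdelt_of (a : gf_action K N) (S : ftscheme) := SDElt { sd1 : N S; sd2 : K S }.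

Section Elements.
Variable S : ftscheme.
Notation sdelt := (sdelt_of act S).
HB.instance Definition _ := gen_eqMixin sdelt.
HB.instance Definition _ := gen_choiceMixin sdelt.

Lemma gact_1 (h : K S) : act S h 1%g = 1%g.
Proof.
apply: (mulgI (act S h 1%g)); by rewrite -gactM !mulg1.
Qed.

Definition sd_one : sdelt := SDElt act 1%g 1%g.
Definition sd_mul (a b : sdelt) : sdelt :=
  SDElt act (sd1 a * act S (sd2 a) (sd1 b))%g (sd2 a * sd2 b)%g.
Definition sd_inv (a : sdelt) : sdelt :=
  SDElt act (act S (sd2 a)^-1 (sd1 a)^-1)%g (sd2 a)^-1%g.

Lemma sd_mulA : associative sd_mul.
Proof. by move=> a b c; rewrite /sd_mul /= gactM gact_mul !mulgA. Qed.
Lemma sd_mul1g : left_id sd_one sd_mul.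
Proof. by case=> a h; rewrite /sd_mul /= gact1 !mul1g. Qed.
Lemma sd_mulg1 : right_id sd_one sd_mul.
Proof. by case=> a h; rewrite /sd_mul /= gact_1 !mulg1. Qed.
Lemma sd_mulVg : left_inverse sd_one sd_inv sd_mul.
Proof.
by case=> a h; rewrite /sd_mul /= -gactM !mulVg gact_1.
Qed.
Lemma sd_mulgV : right_inverse sd_one sd_inv sd_mul.
Proof.
by case=> a h; rewrite /sd_mul /= -gact_mul !mulgV gact1 mulgV.
Qed.
HB.instance Definition _ :=
  isGroup.Build sdelt sd_mulA sd_mul1g sd_mulg1 sd_mulVg sd_mulgV.
End Elements.

Definition sdmap (S T : ftscheme) (u : khom T S) (a : sdelt_of act S) : sdelt_of act T :=
  SDElt act (gmap u (sd1 a)) (gmap u (sd2 a)).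

Definition semidirect : group_functor.
Proof.
refine (@GroupFunctor (fun S => sdelt_of act S) sdmap _ _ _).
- by move=> S T u a b; rewrite /sdmap /= !gmapM gact_nat.
- by move=> S [a h]; rewrite /sdmap /= !gmap_id.
- by move=> S T R u v [a h]; rewrite /sdmap /= !gmap_comp.
Defined.
End SemidirectProduct.

Section Conjugation.
Variables (G : group_functor) (N K : subgroup_functor G) (nN : normal_functor N).

Definition conj_fun S (h : sub_functor K S) (a : sub_functor N S) : sub_functor N S :=
  SGElt (nN (sgval h) (sgvalP a)).

Lemma gmapV S T (u : khom (ftsch T) (ftsch S)) (a : G S) : gmap u (a^-1)%g = ((gmap u a)^-1)%g.
Proof.
have gmap1 : gmap u (1%g : G S) = 1%g.
  by apply: (mulgI (gmap u (1%g : G S))); rewrite -gmapM !mulg1.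
by apply: (mulgI (gmap u a)); rewrite -gmapM !mulgV.
Qed.

Definition conj_action : gf_action (sub_functor K) (sub_functor N).
Proof.
refine (@GFAction _ _ conj_fun _ _ _ _).
- by move=> S h a b; apply: sgelt_eq; rewrite /= !mulgA mulgVK.
- by move=> S a; apply: sgelt_eq; rewrite /= invg1 mulg1 mul1g.
- by move=> S h h' a; apply: sgelt_eq; rewrite /= invgM !mulgA.
- by move=> S T u h a; apply: sgelt_eq; rewrite /= !gmapM gmapV.
Defined.
End Conjugation.

(* The group axioms for the morphisms gs_mul, gs_one, gs_inv are stated on
   T-valued points; taking T = H x H x H (resp. H) and the projections gives the
   usual commutative diagrams. *)
Record group_scheme := GroupScheme {
  gs :> ftscheme;
  gs_sq : kprod gs gs;
  gs_mul : khom gs_sq gs;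
  gs_one : khom kpt gs;
  gs_inv : khom gs gs;
  gs_mulA : forall (T : kscheme) (f g h : khom T gs),
    kcomp gs_mul (kpair gs_sq f (kcomp gs_mul (kpair gs_sq g h))) =
    kcomp gs_mul (kpair gs_sq (kcomp gs_mul (kpair gs_sq f g)) h);
  gs_mul1 : forall (T : kscheme) (f : khom T gs),
    kcomp gs_mul (kpair gs_sq (kcomp gs_one (to_kpt T)) f) = f;
  gs_1mul : forall (T : kscheme) (f : khom T gs),
    kcomp gs_mul (kpair gs_sq f (kcomp gs_one (to_kpt T))) = f;
  gs_mulV : forall (T : kscheme) (f : khom T gs),
    kcomp gs_mul (kpair gs_sq f (kcomp gs_inv f)) = kcomp gs_one (to_kpt T);
  gs_Vmul : forall (T : kscheme) (f : khom T gs),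
    kcomp gs_mul (kpair gs_sq (kcomp gs_inv f) f) = kcomp gs_one (to_kpt T) }.

Section Points.
Variable H : group_scheme.

Section Group.
Variable T : kscheme.
Definition pts : Type := khom T H.
HB.instance Definition _ := gen_eqMixin pts.
HB.instance Definition _ := gen_choiceMixin pts.
Definition pts_mul (f g : pts) : pts := kcomp (gs_mul H) (kpair (gs_sq H) f g).
Definition pts_one : pts := kcomp (gs_one H) (to_kpt T).
Definition pts_inv (f : pts) : pts := kcomp (gs_inv H) f.
HB.instance Definition _ := @isGroup.Build pts pts_one pts_inv pts_mul
  (@gs_mulA H T) (@gs_mul1 H T) (@gs_1mul H T) (@gs_Vmul H T) (@gs_mulV H T).
End Group.

Definition pts_comp T T' (u : khom T' T) (f : pts T) : pts T' := kcomp f u.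

Lemma pts_compM T T' (u : khom T' T) : {morph pts_comp u : f g / (f * g)%g}.
Proof. by move=> f g; rewrite /pts_comp /= -kcompA kpair_comp. Qed.

Lemma pts_comp1 T T' (u : khom T' T) : pts_comp u 1%g = 1%g.
Proof.
apply: (mulgI (pts_comp u 1%g)).
by rewrite -pts_compM !mulg1.
Qed.

Lemma pts_compV T T' (u : khom T' T) (f : pts T) : pts_comp u (f^-1)%g = ((pts_comp u f)^-1)%g.
Proof. by apply: (mulgI (pts_comp u f)); rewrite -pts_compM !mulgV pts_comp1. Qed.

Definition points : group_functor.
Proof.
refine (@GroupFunctor (fun S => pts S) (fun S T u a => pts_comp u a) _ _ _).
- by move=> S T u; exact: pts_compM.
- by move=> S a; exact: kcompf1.
- by move=> S T R u v a; exact: kcompA.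
Defined.
End Points.

(* XS S is a chosen product X x S. A morphism u : T -> S acts on Hom by
   composition with id_X x u. *)
Section HomFunctor.
Variables (X : ftscheme) (H : group_scheme).
Variable XS : forall S : ftscheme, kprod X S.

Definition prod_map (S T : ftscheme) (u : khom T S) : khom (XS T) (XS S) :=
  kpair (XS S) (pr1 (XS T)) (kcomp u (pr2 (XS T))).

Lemma prod_map_id S : prod_map (kid (ftsch S)) = kid (XS S).
Proof. by apply: esym; apply: kpair_uniq; rewrite kcompf1 ?kcomp1f. Qed.

Lemma prod_map_comp (S T R : ftscheme) (u : khom T S) (v : khom R T) :
  prod_map (kcomp u v) = kcomp (prod_map u) (prod_map v).
Proof.
apply: esym; apply: kpair_uniq; rewrite kcompA ?pr1_kpair ?pr2_kpair ?pr1_kpair //.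
by rewrite -kcompA pr2_kpair kcompA.
Qed.

Definition Hom : group_functor.
Proof.
refine (@GroupFunctor (fun S => pts H (XS S))
  (fun S T u f => pts_comp (prod_map u) f) _ _ _).
- by move=> S T u; exact: pts_compM.
- by move=> S f; rewrite /pts_comp prod_map_id; exact: kcompf1.
- by move=> S T R u v f; rewrite /pts_comp prod_map_comp; exact: kcompA.
Defined.

(* The morphism s |-> (x, s) from S to X x S. *)
Definition at_pt (x : khom kpt X) (S : ftscheme) : khom S (XS S) :=
  kpair (XS S) (kcomp x (to_kpt S)) (kid S).

Lemma at_pt_nat x (S T : ftscheme) (u : khom T S) :
  kcomp (prod_map u) (at_pt x T) = kcomp (at_pt x S) u.
Proof.
rewrite /prod_map !kpair_comp pr1_kpair -kcompA pr2_kpair kcompf1 kcomp1f -kcompA.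
by rewrite (to_kpt_uniq (kcomp (to_kpt S) u)).
Qed.

Definition Hom_pt (x : khom kpt X) : subgroup_functor Hom.
Proof.
refine (@SubgroupFunctor Hom
  (fun S => [set f : Hom S | pts_comp (at_pt x S) f = 1%g]) _ _ _ _).
- by move=> S; exact: pts_comp1.
- by move=> S a b /= ha hb; rewrite pts_compM ha hb mulg1.
- by move=> S a /= ha; rewrite pts_compV ha invg1.
- move=> S T u a /= ha.
  by rewrite {1}/pts_comp /= -kcompA at_pt_nat kcompA -[RHS](pts_comp1 H u) -ha.
Defined.

Lemma Hom_pt_normal x : normal_functor (Hom_pt x).
Proof. by move=> S g n /= hn; rewrite !pts_compM hn mulg1 pts_compV mulgV. Qed.

Definition Hom_const : subgroup_functor Hom.
Proof.
refine (@SubgroupFunctor Hom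
  (fun S => [set f : Hom S | exists h : points H S, f = pts_comp (pr2 (XS S)) h]) _ _ _ _).
- by move=> S; exists 1%g; rewrite pts_comp1.
- by move=> S a b [h ->] [h' ->]; exists (h * h')%g; rewrite pts_compM.
- by move=> S a [h ->]; exists (h^-1)%g; rewrite pts_compV.
- move=> S T u a [h ->]; exists (pts_comp u h).
  by rewrite /= /pts_comp -!kcompA pr2_kpair.
Defined.

Definition const_conj (x : khom kpt X) :
    gf_action (sub_functor Hom_const) (sub_functor (Hom_pt x)) :=
  conj_action Hom_const (@Hom_pt_normal x).
End HomFunctor.
End SchemesOverField.

(* Main.v *)
Require Import Defs.
From mathcomp Require Import all_boot ssralg.
Set Implicit Arguments.
Unset Strict Implicit.
Unset Printing Implicit Defensive.

(** Restriction to {x} x S is a retraction [f |-> f(x, .)] of Hom(X x S, H) onto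
    H(S), multiplicative and natural in S, with kernel Hom(X, H; x |-> e_H) and
    with the constant morphisms as a section. Hence every f factors uniquely
    as [(f * c^-1) * c] with [c(y, s) = f(x, s)]. *)

Section ConstantMorphisms.
Variables (k : fieldType) (X : ftscheme k) (x : khom (kpt k) X).
Variables (H : group_scheme k) (XS : forall S : ftscheme k, kprod X S).

Definition const_hom (S : ftscheme k) (h : points H S) : Hom H XS S :=
  pts_comp (pr2 (XS S)) h.

Definition eval_pt (S : ftscheme k) (f : Hom H XS S) : points H S :=
  pts_comp (at_pt XS x S) f.

Lemma const_homM S : {morph @const_hom S : a b / (a * b)%g}.
Proof. exact: pts_compM. Qed.

Lemma eval_ptM S : {morph @eval_pt S : a b / (a * b)%g}.
Proof. exact: pts_compM. Qed.

Lemma eval_ptV S f : @eval_pt S (f^-1)%g = ((eval_pt f)^-1)%g.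
Proof. exact: pts_compV. Qed.

(** The section s |-> (x, s) followed by the projection to S is the identity of S. *)
Lemma const_homK S : cancel (@const_hom S) (@eval_pt S).
Proof. by move=> h; rewrite /eval_pt /pts_comp /= -kcompA pr2_kpair kcompf1. Qed.

Lemma const_hom_nat (S T : ftscheme k) (u : khom T S) h :
  const_hom (gmap u h) = gmap u (const_hom h).
Proof. by rewrite /const_hom /= /pts_comp -!kcompA pr2_kpair. Qed.

Lemma eval_pt_nat (S T : ftscheme k) (u : khom T S) f :
  eval_pt (gmap u f) = gmap u (eval_pt f).
Proof. by rewrite /eval_pt /= /pts_comp -!kcompA at_pt_nat. Qed.

Lemma const_hom_mem S (h : points H S) : sgmem (Hom_const H XS) (const_hom h).
Proof. by exists h. Qed.

(** Membership only asserts that some h exists with f(y, s) = h(s); evaluation at x recovers this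
    h. *)
Lemma eval_constK S (c : sub_functor (Hom_const H XS) S) :
  const_hom (eval_pt (sgval c)) = sgval c.
Proof. by case: c => f [h /= ->]; congr const_hom; exact: const_homK. Qed.

Lemma eval_pt_ker S (n : sub_functor (Hom_pt H XS x) S) :
  eval_pt (sgval n) = 1%g.
Proof. exact: sgvalP n. Qed.

(** f and its constant part take the same value at x, and evaluation at x is a homomorphism. *)
Lemma pt_part_mem S (f : Hom H XS S) :
  sgmem (Hom_pt H XS x) (f * (const_hom (eval_pt f))^-1)%g.
Proof.
by rewrite -[sgmem _ _]/(eval_pt _ = 1%g) eval_ptM eval_ptV const_homK mulgV.
Qed.

Definition points_const S (h : points H S) : sub_functor (Hom_const H XS) S :=
  SGElt (const_hom_mem h).

Definition hom_split S (f : Hom H XS S) : semidirect (const_conj H XS x) S :=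
  SDElt (const_conj H XS x) (SGElt (pt_part_mem f)) (points_const (eval_pt f)).

Lemma points_const_bij S : bijective (@points_const S).
Proof.
exists (fun c => eval_pt (sgval c)) => [|c]; first exact: const_homK.
by apply: sgelt_eq; exact: eval_constK.
Qed.

Lemma points_constM S : {morph @points_const S : a b / (a * b)%g}.
Proof. by move=> a b; apply: sgelt_eq; exact: const_homM. Qed.

Lemma points_const_nat (S T : ftscheme k) (u : khom T S) h :
  points_const (gmap u h) = gmap u (points_const h).
Proof. by apply: sgelt_eq; exact: const_hom_nat. Qed.

(** This is the identification of H with the constant morphisms. *)
Definition points_const_iso : gf_iso (points H) (sub_functor (Hom_const H XS)) :=
  GFIso points_const_bij points_constM points_const_nat.

Lemma sdelt_eq S (a b : semidirect (const_conj H XS x) S) :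
  sgval (sd1 a) = sgval (sd1 b) -> sgval (sd2 a) = sgval (sd2 b) -> a = b.
Proof.
by case: a b => [n c] [n' c'] /= en ec; congr SDElt; exact: sgelt_eq.
Qed.

(** Since n is trivial at x, the constant part of n c is c, and (n c) c^-1 = n. *)
Lemma hom_split_mul S (n : sub_functor (Hom_pt H XS x) S)
    (c : sub_functor (Hom_const H XS) S) :
  hom_split (sgval n * sgval c)%g = SDElt (const_conj H XS x) n c.
Proof.
by apply: sdelt_eq; rewrite /= eval_ptM eval_pt_ker mul1g eval_constK ?mulgK.
Qed.

Lemma hom_split_bij S : bijective (@hom_split S).
Proof.
(* The inverse is multiplication (n, c) |-> n c in [Hom]. *)
exists (fun a : semidirect (const_conj H XS x) S =>
  (sgval (sd1 a) * sgval (sd2 a))%g) => [f|[n c]] /=.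
  exact: mulgVK.
exact: hom_split_mul.
Qed.

(** With c, d the constant parts of f, g, that of f g is c d, and f g (c d)^-1 = (f c^-1) (c (g
    d^-1) c^-1); the second factor is the conjugation action of c. *)
Lemma hom_splitM S : {morph @hom_split S : a b / (a * b)%g}.
Proof.
move=> f g; apply: sdelt_eq; rewrite /= eval_ptM const_homM //.
by rewrite invgM !mulgA mulgVK.
Qed.

Lemma hom_split_nat (S T : ftscheme k) (u : khom T S) f :
  hom_split (gmap u f) = gmap u (hom_split f).
Proof.
apply: sdelt_eq; rewrite [LHS]/= eval_pt_nat const_hom_nat //.
(* By conversion, the transition map of the subgroup functor is that of [Hom], which respects
   products and inverses. *)
rewrite -[RHS]/(gmap u (f * (const_hom (eval_pt f))^-1)%g).
by rewrite gmapM gmapV.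
Qed.

Definition hom_split_iso : gf_iso (Hom H XS) (semidirect (const_conj H XS x)) :=
  GFIso hom_split_bij hom_splitM hom_split_nat.

End ConstantMorphisms.

(** The two equations pin the isomorphisms down: [i] is h |-> h o pr_S, and the inverse of [phi] is
    multiplication in [Hom]. *)
Theorem lemma2p6 (k : fieldType) (X : ftscheme k) (x : khom (kpt k) X)
    (H : group_scheme k) (XS : forall S : ftscheme k, kprod X S) :
  exists (i : gf_iso (points H) (sub_functor (Hom_const H XS)))
    (phi : gf_iso (Hom H XS) (semidirect (const_conj H XS x))),
    (forall (S : ftscheme k) (h : points H S),
       sgval (i S h) = pts_comp (pr2 (XS S)) h) /\
    (forall (S : ftscheme k) (n : sub_functor (Hom_pt H XS x) S)
            (c : sub_functor (Hom_const H XS) S),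
       phi S (sgval n * sgval c)%g = SDElt (const_conj H XS x) n c).
Proof.
exists (points_const_iso x H XS), (hom_split_iso x H XS).
by split=> // S n c; exact: hom_split_mul.
Qed.
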